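(* Let $\mathcal{F}=(\mathcal{F}_1,\dots,\mathcal{F}_r)$ be a flag of type $(t_1,\dots,t_r)$ on $\mathbb{F}_q^n$, let $a=\max\{i\mid 2t_i\leq n\}$, $b=\min\{i\mid 2t_i\geq n\}$, and let $\mathbf{H}$ be a subgroup of $\mathrm{GL}(n,q)$. The following are equivalent: (i) The flag code $\mathrm{Orb}_{\mathbf{H}}(\mathcal{F})$ is an optimum distance flag code. (ii) $\mathrm{Orb}_{\mathbf{H}}(\mathcal{F}_a)$ and $\mathrm{Orb}_{\mathbf{H}}(\mathcal{F}_b)$ are of maximum distance and $\mathrm{Stab}_{\mathbf{H}}(\mathcal{F}_a)=\mathrm{Stab}_{\mathbf{H}}(\mathcal{F}_b)\subseteq\mathrm{Stab}_{\mathbf{H}}(\mathcal{F}_i)$ for every $1\leq i\leq r$. (iii) $\mathrm{Orb}_{\mathbf{H}}(\mathcal{F}_a)$ and $\mathrm{Orb}_{\mathbf{H}}(\mathcal{F}_b)$ are of maximum distance and $\mathrm{Stab}_{\mathbf{H}}(\mathcal{F}_a)=\mathrm{Stab}_{\mathbf{H}}(\mathcal{F}_b)\subseteq\mathrm{Stab}_{\mathbf{H}}(\mathcal{F})$. (iv) $\mathrm{Orb}_{\mathbf{H}}(\mathcal{F}_a)$ and $\mathrm{Orb}_{\mathbf{H}}(\mathcal{F}_b)$ are of maximum distance and $|\mathrm{Stab}_{\mathbf{H}}(\mathcal{F}_a)|=|\mathrm{Stab}_{\mathbf{H}}(\mathcal{F}_b)|\leq|\mathrm{Stab}_{\mathbf{H}}(\mathcal{F})|$.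 Moreover, the cardinality of such a flag code is $|\mathrm{Orb}_{\mathbf{H}}(\mathcal{F})|=|\mathrm{Orb}_{\mathbf{H}}(\mathcal{F}_a)|=|\mathrm{Orb}_{\mathbf{H}}(\mathcal{F}_b)|$.
   Context: A flag of type $(t_1,\dots,t_r)$, $0<t_1<\dots<t_r<n$, is a chain $\mathcal{F}_1\subsetneq\cdots\subsetneq\mathcal{F}_r$ of subspaces of $\mathbb{F}_q^n$ with $\dim\mathcal{F}_i=t_i$. $\mathrm{GL}(n,q)$ acts on subspaces by $\mathcal{V}\cdot A=\mathrm{rowsp}(VA)$ where $\mathcal{V}=\mathrm{rowsp}(V)$, and on flags componentwise: $\mathcal{F}\cdot A=(\mathcal{F}_1\cdot A,\dots,\mathcal{F}_r\cdot A)$. For a subgroup $\mathbf{H}$, orbits $\mathrm{Orb}_{\mathbf{H}}(\cdot)$ and stabilizers $\mathrm{Stab}_{\mathbf{H}}(\cdot)$ are the usual ones for this action. $d_S(\mathcal{U},\mathcal{V})=\dim(\mathcal{U}+\mathcal{V})-\dim(\mathcal{U}\cap\mathcal{V})$; a set $\mathcal{C}$ of $k$-dimensional subspaces has minimum distance the least distance between distinct members ($0$ if $|\mathcal{C}|=1$) and is of maximum distance if this equals $2k$ when $2k\leq n$ and $2(n-k)$ when $2k\geq n$. For a flag code $\mathcal{C}$ (nonempty set of flags of one type), $d_f(\mathcal{F},\mathcal{F}')=\sum_i d_S(\mathcal{F}_i,\mathcal{F}'_i)$, $d_f(\mathcal{C})$ is the least flag distance between distinct members ($0$ if $|\mathcal{C}|=1$),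 and $\mathcal{C}$ is an optimum distance flag code if $d_f(\mathcal{C})=2\left(\sum_{2t_i\leq n}t_i+\sum_{2t_i>n}(n-t_i)\right)$. If one of the indices $a,b$ does not exist (its defining set is empty), conditions referring to it are omitted. *)

(* Defs.v *)
From HB Require Import structures.
From mathcomp Require Import all_boot all_order all_algebra all_fingroup.

Set Implicit Arguments.
Unset Strict Implicit.
Unset Printing Implicit Defensive.

Import GRing.Theory.

Local Open Scope ring_scope.

Section FiniteSubspaces.
Variables (K : finFieldType) (vT : vectType K).

Let vs2mxK := @VectorInternalTheory.vs2mxK K vT.

HB.instance Definition _ : isCountable {vspace vT} := CanIsCountable vs2mxK.
HB.instance Definition _ : isFinite {vspace vT} := CanIsFinite vs2mxK.

End FiniteSubspaces.

Local Open Scope nat_scope.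

Section MinimumDistance.
Variables (T : finType) (d : T -> T -> nat).

(* The least distance between distinct members of C, and 0 if there is no pair
   of distinct members. *)
Definition min_dist (C : {set T}) : nat :=
  let D := [pred p : T * T | [&& p.1 \in C, p.2 \in C & p.1 != p.2]] in
  if [pick p in D] is Some p0 then
    let p := [arg min_(p < p0 in D) d p.1 p.2] in d p.1 p.2
  else 0.

End MinimumDistance.

Section SubspaceCodes.
Variables (K : finFieldType) (vT : vectType K).
Implicit Types (U V : {vspace vT}).

(* No truncation: U :&: V is a subspace of U + V. *)
Definition subspace_dist U V : nat := \dim (U + V) - \dim (U :&: V).

(* C is meant to consist of k-dimensional subspaces of an n-dimensional space. *)
Definition maximum_distance (n k : nat) (C : {set {vspace vT}}) : Prop :=
  min_dist subspace_dist C = if 2 * k <= n then 2 * k else 2 * (n - k).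

End SubspaceCodes.

Section Flags.
Variables (K : finFieldType) (vT : vectType K) (n r : nat).
Implicit Types (t : 'I_r -> nat) (F : {ffun 'I_r -> {vspace vT}}).

Definition type_vector t : Prop :=
  (forall i, 0 < t i < n) /\ (forall i j : 'I_r, i < j -> t i < t j).

Definition flag t F : Prop :=
  [/\ type_vector t,
      forall i j : 'I_r, i < j -> (F i <= F j)%VS && (F i != F j)
    & forall i, \dim (F i) = t i].

Definition flag_dist F F' : nat := \sum_i subspace_dist (F i) (F' i).

Definition optimum_distance t (C : {set {ffun 'I_r -> {vspace vT}}}) : Prop :=
  min_dist flag_dist C =
    2 * (\sum_(i | 2 * t i <= n) t i + \sum_(i | 2 * t i > n) (n - t i)).

(* Relational, because either index may fail to exist; quantifying universally
   over the a with is_index_a t a omits the condition when there is none. *)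
Definition is_index_a t (a : 'I_r) : Prop :=
  2 * t a <= n /\ forall i : 'I_r, 2 * t i <= n -> i <= a.

Definition is_index_b t (b : 'I_r) : Prop :=
  2 * t b >= n /\ forall i : 'I_r, 2 * t i >= n -> b <= i.

End Flags.

Section LinearGroupAction.
Variables (K : finFieldType) (n r : nat).
Local Notation V := 'rV[K]_n.+1.
Local Notation GL := {'GL_n.+1[K]}.

(* The image of U under v |-> v *m A: rowsp M is mapped to rowsp (M *m A). *)
Definition subspace_act (U : {vspace V}) (A : GL) : {vspace V} :=
  (linfun (mulmxr (GLval A : 'M[K]_n.+1)) @: U)%VS.

Fact subspace_act1 : subspace_act^~ 1%g =1 id.
Proof.
move=> U; rewrite /subspace_act.
have -> : linfun (mulmxr (1%:M : 'M[K]_n.+1)) = \1%VF :> 'End(V).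
  by apply/lfunP => v; rewrite lfunE id_lfunE /= mulmx1.
exact: lim1g.
Qed.

Fact subspace_actM U : act_morph subspace_act U.
Proof.
move=> A B; rewrite /subspace_act -limg_comp; congr (_ @: U)%VS.
by apply/lfunP => v; rewrite comp_lfunE !lfunE /=; exact: mulmxA.
Qed.

Definition subspace_action : {action GL &-> {vspace V}} :=
  TotalAction subspace_act1 subspace_actM.

Definition flag_act (F : {ffun 'I_r -> {vspace V}}) (A : GL) :
  {ffun 'I_r -> {vspace V}} := [ffun i => subspace_act (F i) A].

Fact flag_act1 : flag_act^~ 1%g =1 id.
Proof. by move=> F; apply/ffunP => i; rewrite ffunE subspace_act1. Qed.

Fact flag_actM F : act_morph flag_act F.
Proof. by move=> A B; apply/ffunP => i; rewrite !ffunE subspace_actM. Qed.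

Definition flag_action : {action GL &-> {ffun 'I_r -> {vspace V}}} :=
  TotalAction flag_act1 flag_actM.

End LinearGroupAction.

Arguments subspace_action {K n}.
Arguments flag_action {K n r}.

(* Main.v *)
(* Every component of two flags of the same type is at distance at most the
   maximum, so a flag code is optimum exactly when all components of distinct
   members are at maximum distance, hence distinct: the stabilizer of a flag
   with optimum orbit is that of each of its components.  Conversely, maximum
   distance at a means that distinct members of the orbit meet trivially, which
   passes to the components below a; at b it means that they span the whole
   space, which passes to the components above b; and each index is on one of
   these two sides. *)
Require Import Defs.
From mathcomp Require Import all_boot all_order all_algebra all_fingroup.
From mathcomp Require Import zify.

Set Implicit Arguments.
Unset Strict Implicit.
Unset Printing Implicit Defensive.

Local Open Scope nat_scope.

(** * Minimum distances equal to an upper bound, and comparison of stabilizers *)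

(** Since [m] is positive it cannot be the default value 0 of [min_dist], so a pair of distinct
    members exists. A minimum equal to an upper bound forces all the distances to be equal. *)
Lemma min_dist_eqP (T : finType) (d : T -> T -> nat) (C : {set T}) (m : nat) :
  0 < m -> {in C &, forall x y, d x y <= m} ->
  min_dist d C = m <->
    (exists x y, [/\ x \in C, y \in C & x != y]) /\
    {in C &, forall x y, x != y -> d x y = m}.
Proof.
move=> m_gt0 d_le; rewrite /min_dist.
case: pickP => [[x0 y0] p0D | D0]; last first.
  split=> [m0 | [[x [y [xC yC xy]]] _]]; first by rewrite -m0 in m_gt0.
  by have := D0 (x, y); rewrite inE /= xC yC xy.
case: arg_minnP => // -[x y] /and3P[/= xC yC xy] min_xy.
split=> [dxy | [_ d_eq]]; last exact: d_eq.
split=> [|u v uC vC uv]; first by exists x, y.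
apply/eqP; rewrite eqn_leq d_le //= -dxy.
by apply: (min_xy (u, v)); apply/and3P.
Qed.

(** Two elements agree at a point exactly when their quotient [g * h^-1] fixes it. Used with a
    component of a flag for [x] and the whole flag for [y]. *)
Lemma act_eq_stab (aT : finGroupType) (T1 T2 : finType)
    (to1 : {action aT &-> T1}) (to2 : {action aT &-> T2}) (G : {group aT})
    (x : T1) (y : T2) (g h : aT) :
  'C_G[x | to1]%g \subset 'C_G[y | to2]%g -> g \in G -> h \in G ->
  to1 x g = to1 x h -> to2 y g = to2 y h.
Proof.
move=> /subsetP sxy gG hG xgh.
have : (g * h^-1)%g \in 'C_G[x | to1]%g.
  by rewrite inE groupM ?groupV //=; apply/astab1P; rewrite actM xgh actK.
move=> /sxy; rewrite inE => /andP[_ /astab1P yE].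
by rewrite -{2}yE -actM mulgKV.
Qed.

(** The largest distance that dimension alone allows between [k]-dimensional subspaces; the two
    branches agree when [2 * k = n]. *)
Definition max_dist (n k : nat) : nat := if 2 * k <= n then 2 * k else 2 * (n - k).

Lemma max_dist_gt0 n k : 0 < k < n -> 0 < max_dist n k.
Proof. by rewrite /max_dist; case: ifP; lia. Qed.

Lemma sum_max_dist n r (t : 'I_r -> nat) :
  2 * (\sum_(i | 2 * t i <= n) t i + \sum_(i | 2 * t i > n) (n - t i)) =
  \sum_i max_dist n (t i).
Proof.
rewrite mulnDr !big_distrr /= [RHS](bigID (fun i => 2 * t i <= n)) /=.
congr addn; last under eq_bigl do rewrite ltnNge.
  by apply: eq_bigr => i; rewrite /max_dist => ->.
by apply: eq_bigr => i /negPf; rewrite /max_dist => ->.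
Qed.

(** * The distance between two subspaces of equal dimension *)

Section SubspaceDistance.
Variables (K : finFieldType) (vT : vectType K) (n : nat).
Hypothesis dimT : \dim {:vT} = n.
Implicit Types U V : {vspace vT}.

(** As the dimensions of sum and intersection add up to [2 * k], the distance is [2 * k] minus twice
    the dimension of the intersection, and also twice the dimension of the sum minus [2 * k]. The
    first form gives the bound [2 * k], the second [2 * (n - k)]. *)
Lemma subspace_dist_le U V k :
  \dim U = k -> \dim V = k -> subspace_dist U V <= max_dist n k.
Proof.
move=> dU dV; rewrite /subspace_dist /max_dist.
have := dimv_sum_cap U V; have := dimvS (subvf (U + V)%VS).
by rewrite dimT dU dV; case: ifP; lia.
Qed.

Lemma subspace_dist_max_le U V k : \dim U = k -> \dim V = k -> 2 * k <= n ->
  subspace_dist U V = max_dist n k <-> \dim (U :&: V) = 0.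
Proof.
clear dimT => dU dV k_le; rewrite /subspace_dist /max_dist k_le.
have := dimv_sum_cap U V; have := dimvS (capvSl U V).
by rewrite dU dV; lia.
Qed.

Lemma subspace_dist_max_ge U V k : \dim U = k -> \dim V = k -> n <= 2 * k ->
  subspace_dist U V = max_dist n k <-> \dim (U + V) = n.
Proof.
move=> dU dV k_ge; rewrite /subspace_dist /max_dist.
have := dimv_sum_cap U V; have := dimvS (subvf (U + V)%VS).
have := dimvS (subvf U); have := dimvS (capvSl U V).
by rewrite dimT dU dV; case: ifP; lia.
Qed.

End SubspaceDistance.

(** A linear image never has larger dimension; applying this to [A] and to its inverse gives both
    inequalities. *)
Lemma dim_subspace_act (K : finFieldType) (n : nat)
    (U : {vspace 'rV[K]_n.+1}) (A : {'GL_n.+1[K]}) :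
  \dim (subspace_act U A) = \dim U.
Proof.
have dim_le W B : \dim (subspace_act W B) <= \dim W.
  by rewrite -(limg_ker_dim (linfun (mulmxr (GLval B))) W) leq_addl.
by apply/eqP; rewrite eqn_leq dim_le -{1}(actK subspace_action A U) dim_le.
Qed.

(** * The stabilizer of a flag as the intersection of those of its components *)

Section FlagStabilizer.
Variables (K : finFieldType) (n r : nat) (F : {ffun 'I_r -> {vspace 'rV[K]_n.+1}}).
Variable H : {group {'GL_n.+1[K]}}.

Lemma flag_stab_sub i :
  'C_H[F | flag_action]%g \subset 'C_H[F i | subspace_action]%g.
Proof.
apply/subsetP => A /setIP[AH /astab1P FA]; apply/setIP; split=> //.
by apply/astab1P; rewrite -{2}FA /= ffunE.
Qed.

Lemma sub_flag_stab (S : {set {'GL_n.+1[K]}}) : S \subset H ->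
  (forall i, S \subset 'C_H[F i | subspace_action]%g) ->
  S \subset 'C_H[F | flag_action]%g.
Proof.
move=> sSH sS; rewrite subsetI sSH; apply/subsetP => A AS.
apply/astab1P/ffunP => i; rewrite ffunE.
by have /subsetP/(_ A AS)/setIP[_ /astab1P] := sS i.
Qed.

End FlagStabilizer.

(** * Distances in the orbits of a flag and of its components *)

Section OrbitDistances.
Variables (K : finFieldType) (n r : nat) (t : 'I_r -> nat).
Variables (F : {ffun 'I_r -> {vspace 'rV[K]_n.+1}}) (H : {group {'GL_n.+1[K]}}).
Hypothesis flagF : flag n.+1 t F.

Local Notation Orb i := (orbit subspace_action H (F i)).
Local Notation OrbF := (orbit flag_action H F).
Local Notation Stab i := ('C_H[F i | subspace_action])%g.
Local Notation StabF := ('C_H[F | flag_action])%g.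

Let dimV : \dim {: 'rV[K]_n.+1} = n.+1.
Proof. by rewrite dimvf /dim /= mul1n. Qed.

Let dim_act i A : \dim (subspace_act (F i) A) = t i.
Proof. by have [_ _ dimF] := flagF; rewrite dim_subspace_act. Qed.

Let t_bounds i : 0 < t i < n.+1.
Proof. by have [[]] := flagF. Qed.

Let subF (i j : 'I_r) : i <= j -> (F i <= F j)%VS.
Proof.
have [_ F_lt _] := flagF.
rewrite leq_eqVlt => /orP[/eqP/val_inj-> // | /F_lt/andP[] //].
Qed.

(** Describing orbit members by group elements lets one pair [A], [B] be followed through all the
    components of the flag. *)
Lemma maximum_distance_orbitP i :
  maximum_distance n.+1 (t i) (Orb i) <->
    (exists A B, [/\ A \in H, B \in H &
        subspace_act (F i) A != subspace_act (F i) B]) /\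
    {in H &, forall A B, subspace_act (F i) A != subspace_act (F i) B ->
        subspace_dist (subspace_act (F i) A) (subspace_act (F i) B)
        = max_dist n.+1 (t i)}.
Proof.
apply: iff_trans (min_dist_eqP (max_dist_gt0 (t_bounds i)) _) _.
  move=> _ _ /orbitP[A _ <-] /orbitP[B _ <-].
  by apply: (subspace_dist_le dimV); apply: dim_act.
split=> -[[x [y [xO yO xy]]] dE].
  move: xO yO xy => /orbitP[A AH <-] /orbitP[B BH <-] xy.
  split; first by exists A, B.
  by move=> ? ? ? ?; apply: dE; apply: mem_orbit.
split; first by do 2!eexists; split; [exact: mem_orbit xO | exact: mem_orbit yO | ].
by move=> _ _ /orbitP[A AH <-] /orbitP[B BH <-]; apply: dE.
Qed.

(** Each term is at most [max_dist], so the sum reaches the sum of the bounds only if every term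
    reaches its own. *)
Lemma flag_dist_eqP A B :
  flag_dist (flag_act F A) (flag_act F B) = \sum_i max_dist n.+1 (t i) <->
  forall i, subspace_dist (subspace_act (F i) A) (subspace_act (F i) B)
            = max_dist n.+1 (t i).
Proof.
rewrite /flag_dist; under eq_bigr do rewrite !ffunE.
split=> [dE i | dE]; last by apply: eq_bigr.
have dist_le j : true ->
    subspace_dist (subspace_act (F j) A) (subspace_act (F j) B)
      <= max_dist n.+1 (t j)
      ?= iff (subspace_dist (subspace_act (F j) A) (subspace_act (F j) B)
              == max_dist n.+1 (t j)).
  by move=> _; split=> //; apply: (subspace_dist_le dimV); apply: dim_act.
have [_] := leqif_sum dist_le; rewrite dE eqxx => /esym/forallP/(_ i).
by move/eqP.
Qed.

Lemma optimum_distance_orbitP : 0 < r ->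
  optimum_distance n.+1 t OrbF <->
    (exists A B, [/\ A \in H, B \in H & flag_act F A != flag_act F B]) /\
    {in H &, forall A B, flag_act F A != flag_act F B -> forall i,
        subspace_dist (subspace_act (F i) A) (subspace_act (F i) B)
        = max_dist n.+1 (t i)}.
Proof.
move=> r_gt0; rewrite /optimum_distance sum_max_dist.
apply: iff_trans (min_dist_eqP _ _) _.
(* The bound is positive because the flag has at least one component, and that component's term is
   positive. *)
- rewrite (bigD1 (Ordinal r_gt0)) //= ltn_addr //.
  exact: max_dist_gt0 (t_bounds _).
- move=> _ _ /orbitP[A _ <-] /orbitP[B _ <-]; apply: leq_sum => i _ /=.
  by rewrite !ffunE; apply: (subspace_dist_le dimV); apply: dim_act.
split=> -[[x [y [xO yO xy]]] dE].
  move: xO yO xy => /orbitP[A AH <-] /orbitP[B BH <-] xy.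
  split; first by exists A, B.
  by move=> ? ? ? ? ?; apply/flag_dist_eqP; apply: dE => //; apply: mem_orbit.
split; first by do 2!eexists; split; [exact: mem_orbit xO | exact: mem_orbit yO | ].
by move=> _ _ /orbitP[A AH <-] /orbitP[B BH <-] AB; apply/flag_dist_eqP/dE.
Qed.

Lemma max_dist_component_neq A B i :
  subspace_dist (subspace_act (F i) A) (subspace_act (F i) B)
    = max_dist n.+1 (t i) ->
  subspace_act (F i) A != subspace_act (F i) B.
Proof.
move=> dE; apply/eqP => AB; have := max_dist_gt0 (t_bounds i).
by rewrite -dE AB /subspace_dist addvv capvv subnn.
Qed.

(** * Consequences of optimum distance for the components *)

(** If [A] fixed [F i] but moved [F], then [F] and its image would be distinct members of the orbit,
    hence at positive distance in component [i]. *)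
Lemma optimum_stab_sub i : 0 < r -> optimum_distance n.+1 t OrbF ->
  Stab i \subset StabF.
Proof.
move=> r_gt0 /(optimum_distance_orbitP r_gt0)[_ dE].
apply/subsetP => A /setIP[AH /astab1P FA]; apply/setIP; split=> //.
(* Writing [F] as its image under 1 makes both flags orbit members, to which [dE] applies. *)
apply/astab1P; rewrite -[RHS](act1 flag_action); apply/eqP.
case: eqVneq => // /(dE A _ AH (group1 H))/(_ i)/max_dist_component_neq.
by rewrite -[subspace_act _ A]/(subspace_action _ A) FA subspace_act1 eqxx.
Qed.

Lemma optimum_stab_eq i : 0 < r -> optimum_distance n.+1 t OrbF ->
  Stab i = StabF.
Proof.
move=> r_gt0 opt; apply/eqP.
by rewrite eqEsubset optimum_stab_sub // flag_stab_sub.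
Qed.

Lemma optimum_maximum_distance i : 0 < r -> optimum_distance n.+1 t OrbF ->
  maximum_distance n.+1 (t i) (Orb i).
Proof.
move=> r_gt0 /(optimum_distance_orbitP r_gt0)[[A [B [AH BH AB]]] dE].
apply/maximum_distance_orbitP; split.
  by exists A, B; split => //; apply: max_dist_component_neq (dE A B AH BH AB i).
move=> C D CH DH CD; apply: dE => //.
by apply: contra CD => /eqP/ffunP/(_ i); rewrite !ffunE => /eqP.
Qed.

(** * Propagation of maximum distance along the flag, and sufficiency of the conditions at [a] and
    [b] *)

(** The images of [F i] lie in those of [F j], so their intersection lies in one that is zero. *)
Lemma max_dist_down A B (i j : 'I_r) : i <= j -> 2 * t j <= n.+1 ->
  subspace_dist (subspace_act (F j) A) (subspace_act (F j) B)
    = max_dist n.+1 (t j) ->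
  subspace_dist (subspace_act (F i) A) (subspace_act (F i) B)
    = max_dist n.+1 (t i).
Proof.
move=> ij tj.
have ti : 2 * t i <= n.+1.
  have [_ _ dimF] := flagF; apply: leq_trans tj.
  by rewrite leq_pmul2l // -!dimF dimvS ?subF.
move/(subspace_dist_max_le (dim_act _ _) (dim_act _ _) tj) => cap0.
apply/(subspace_dist_max_le (dim_act _ _) (dim_act _ _) ti).
by apply/eqP; rewrite -leqn0 -[leqRHS]cap0 dimvS // capvS // limgS ?subF.
Qed.

(** Dually, the images of [F i] contain those of [F j], whose sum is already the whole space. *)
Lemma max_dist_up A B (i j : 'I_r) : j <= i -> n.+1 <= 2 * t j ->
  subspace_dist (subspace_act (F j) A) (subspace_act (F j) B)
    = max_dist n.+1 (t j) ->
  subspace_dist (subspace_act (F i) A) (subspace_act (F i) B)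
    = max_dist n.+1 (t i).
Proof.
move=> ji tj.
have ti : n.+1 <= 2 * t i.
  have [_ _ dimF] := flagF; apply: leq_trans tj _.
  by rewrite leq_pmul2l // -!dimF dimvS ?subF.
move/(subspace_dist_max_ge dimV (dim_act _ _) (dim_act _ _) tj) => sumT.
apply/(subspace_dist_max_ge dimV (dim_act _ _) (dim_act _ _) ti).
apply/eqP; rewrite eqn_leq -[leqRHS]dimV dimvS ?subvf //= -[leqLHS]sumT dimvS //.
by rewrite addvS // limgS ?subF.
Qed.

(** A single component of at most half the dimension suffices for [a] to exist, and [a] is then the
    last such index. *)
Lemma index_a_ex (i : 'I_r) : 2 * t i <= n.+1 -> exists2 a : 'I_r, is_index_a n.+1 t a & i <= a.
Proof.
move=> ti; case: (@arg_maxnP _ i (fun j => 2 * t j <= n.+1) val ti) => a ta a_max.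
by exists a; [split | exact: a_max].
Qed.

Lemma index_b_ex (i : 'I_r) : n.+1 <= 2 * t i -> exists2 b : 'I_r, is_index_b n.+1 t b & b <= i.
Proof.
move=> ti; case: (@arg_minnP _ i (fun j => n.+1 <= 2 * t j) val ti) => b tb b_min.
by exists b; [split | exact: b_min].
Qed.

Lemma flag_act_neq_component A B i : Stab i \subset StabF ->
  A \in H -> B \in H -> flag_act F A != flag_act F B ->
  subspace_act (F i) A != subspace_act (F i) B.
Proof.
move=> sS AH BH; apply: contra => /eqP AB; apply/eqP.
exact: (act_eq_stab sS AH BH AB).
Qed.

Lemma optimum_of_stab_sub : 0 < r ->
  (forall a, is_index_a n.+1 t a ->
    maximum_distance n.+1 (t a) (Orb a) /\ Stab a \subset StabF) ->
  (forall b, is_index_b n.+1 t b ->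
    maximum_distance n.+1 (t b) (Orb b) /\ Stab b \subset StabF) ->
  optimum_distance n.+1 t OrbF.
Proof.
move=> r_gt0 Ha Hb; apply/optimum_distance_orbitP => //; split.
  (* The first component lies on one of the two sides, so at least one of [a] and [b] exists; the
     orbit of that component supplies two distinct members. *)
  have [j max_j] : exists j, maximum_distance n.+1 (t j) (Orb j).
    case: (leqP (2 * t (Ordinal r_gt0)) n.+1) => [/index_a_ex[a /Ha[]] | ].
      by exists a.
    by move/ltnW/index_b_ex => [b /Hb[]]; exists b.
  have /maximum_distance_orbitP[[A [B [AH BH AB]]] _] := max_j.
  exists A, B; split=> //; apply: contra AB => /eqP/ffunP/(_ j).
  by rewrite !ffunE => ->.
(* Distinct flags differ at [a] (or [b]) by the inclusion of stabilizers, hence are at maximum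
   distance there, and this propagates to [i]. *)
move=> A B AH BH AB i; case: (leqP (2 * t i) n.+1) => [ti | /ltnW ti].
  have [a ia le_ia] := index_a_ex ti.
  have [/maximum_distance_orbitP[_ dE] sS] := Ha a ia.
  apply: (max_dist_down (j := a)) => //; first by case: ia.
  exact: dE (flag_act_neq_component sS AH BH AB).
have [b ib le_bi] := index_b_ex ti.
have [/maximum_distance_orbitP[_ dE] sS] := Hb b ib.
apply: (max_dist_up (j := b)) => //; first by case: ib.
exact: dE (flag_act_neq_component sS AH BH AB).
Qed.

End OrbitDistances.

Unset Implicit Arguments.

(** The inclusions, or inequalities, are stated for [a] and [b] separately, because the equality
    between the two stabilizers is void when one index is missing. *)
Theorem theorem4p11 (K : finFieldType) (n r : nat) (t : 'I_r -> nat)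
    (F : {ffun 'I_r -> {vspace 'rV[K]_n.+1}}) (H : {group {'GL_n.+1[K]}})
    (r_gt0 : 0 < r) (flagF : flag n.+1 t F) :
  let Orb i := orbit subspace_action H (F i) in
  let OrbF := orbit flag_action H F in
  let Stab i := ('C_H[F i | subspace_action])%g in
  let StabF := ('C_H[F | flag_action])%g in
  let max_dist_ab :=
    (forall a, is_index_a n.+1 t a -> maximum_distance n.+1 (t a) (Orb a)) /\
    (forall b, is_index_b n.+1 t b -> maximum_distance n.+1 (t b) (Orb b)) in
  let cond_i := optimum_distance n.+1 t OrbF in
  let cond_ii :=
    [/\ max_dist_ab,
        forall a b, is_index_a n.+1 t a -> is_index_b n.+1 t b ->
          Stab a = Stab b,
        forall a, is_index_a n.+1 t a -> forall i, Stab a \subset Stab i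
      & forall b, is_index_b n.+1 t b -> forall i, Stab b \subset Stab i] in
  let cond_iii :=
    [/\ max_dist_ab,
        forall a b, is_index_a n.+1 t a -> is_index_b n.+1 t b ->
          Stab a = Stab b,
        forall a, is_index_a n.+1 t a -> Stab a \subset StabF
      & forall b, is_index_b n.+1 t b -> Stab b \subset StabF] in
  let cond_iv :=
    [/\ max_dist_ab,
        forall a b, is_index_a n.+1 t a -> is_index_b n.+1 t b ->
          #|Stab a| = #|Stab b|,
        forall a, is_index_a n.+1 t a -> #|Stab a| <= #|StabF|
      & forall b, is_index_b n.+1 t b -> #|Stab b| <= #|StabF|] in
  [<-> cond_i; cond_ii; cond_iii; cond_iv] /\
  (cond_i ->
    (forall a, is_index_a n.+1 t a -> #|OrbF| = #|Orb a|) /\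
    (forall b, is_index_b n.+1 t b -> #|OrbF| = #|Orb b|)).
Proof.
move=> Orb OrbF Stab StabF max_dist_ab cond_i cond_ii cond_iii cond_iv.
have stab_eq : cond_i -> forall i, Stab i = StabF.
  by move=> opt i; apply: (optimum_stab_eq flagF).
have sFS i : StabF \subset Stab i by apply: flag_stab_sub.
split; last first.
  (* An orbit has as many members as its stabilizer has cosets in [H], and the stabilizers
     coincide. *)
  by move=> opt; split=> i _; rewrite !card_orbit; rewrite -/StabF -(stab_eq opt i).
tfae.
- move=> opt; split.
  + by split=> i _; apply: (optimum_maximum_distance flagF).
  + by move=> a b _ _; rewrite !stab_eq.
  + by move=> a _ i; rewrite !stab_eq.
  + by move=> b _ i; rewrite !stab_eq.
- case=> max_ab Sab Sa Sb; split=> // i ii.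
  + by apply: sub_flag_stab; [exact: subsetIl | exact: Sa].
  + by apply: sub_flag_stab; [exact: subsetIl | exact: Sb].
- case=> max_ab Sab Sa Sb; split=> // [a b ia ib | a /Sa | b /Sb].
  + by rewrite (Sab a b).
  + exact: subset_leq_card.
  + exact: subset_leq_card.
(* The stabilizer of the flag always lies in that of a component, so the inequality of cardinalities
   forces equality. *)
- have sub_of_card i : #|Stab i| <= #|StabF| -> Stab i \subset StabF.
    by rewrite (geq_leqif (subset_leqif_cards (sFS i))) => /eqP <-.
  case=> -[max_a max_b] _ Sa Sb; apply: (optimum_of_stab_sub flagF r_gt0) => i ii.
  + by split; [exact: max_a | apply/sub_of_card/Sa].
  + by split; [exact: max_b | apply/sub_of_card/Sb].
Qed.
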